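(* Run the method RR-sc with the blockwise step sizes $\alpha_t=\alpha_{\rm sc}^{(k)}$ for $t\in\{T_k,\dots,T_k+S_k-1\}$, $k=0,1,2,\dots$ (all defined in the context). There exists an event $\mathcal E$ with $\mathbb{P}[\mathcal E]\ge1-\delta$, on which $$f(x_{t+1})-f(x_t)<-\frac{\alpha_t n}{4}\eta^2\varepsilon^2\qquad\text{for all } t=0,1,\dots,\tau-1,$$ and such that the following holds: for any block index $K\ge0$ satisfying $$\sum_{k=0}^{K}\frac{nS_k\,\alpha_{\rm sc}^{(k)}}{4}\eta^2\varepsilon^2\ \ge\ f(x_0)-\bar f,$$ on $\mathcal E$ the stopping time $\tau$ of RR-sc satisfies $$\tau\le T_{K+1}-1,$$ where $T_{K+1}=\sum_{k=0}^{K}S_k$ is the starting epoch of block $K+1$.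
   Context: Problem: $f(x)=\frac1n\sum_{i=1}^n f_i(x)$ on $\mathbb{R}^d$. Each $f_i:\mathbb{R}^d\to\mathbb{R}$ is continuously differentiable (not necessarily convex), bounded from below by $\bar f_i\in\mathbb{R}$, and $\nabla f_i$ is Lipschitz continuous with parameter $L>0$. Let $\bar f$ be a lower bound of $f$ (e.g. its optimal value), and set $A=2L>0$ and $B=\frac{A}{n}\sum_{i=1}^n(\bar f-\bar f_i)$, with $\bar f$ such that $B\ge0$ (automatic if $\bar f=\inf f$). Set $F:=3(f(x_0)-\bar f)+3B/A\ge0$. $\|\cdot\|$ is the Euclidean norm. RR-sc with tolerance $\eta>0$ and accuracy $\varepsilon>0$: let $\Pi$ be the set of all permutations of $\{1,\dots,n\}$. Starting from a deterministic $x_0$, at epoch $t=0,1,\dots$ a permutation $\pi_t=(\pi_t^1,\dots,\pi_t^n)$ is sampled uniformly at random from $\Pi$, independently of the past; set $x_t^0=x_t$, $x_t^i=x_t^{i-1}-\alpha_t\nabla f_{\pi_t^i}(x_t^{i-1})$ for $i=1,\dots,n$, and $g_t=\frac1n\sum_{i=1}^n\nabla f_{\pi_t^i}(x_t^{i-1})$. If $\|g_t\|\le\eta\varepsilon$, the method stops, sets $\tau=t$ and returns $x_\tau$; otherwise $x_{t+1}=x_t^n$ and it continues. Thus $\tau$ is the first $t$ with $\|g_t\|\le\eta\varepsilon$ ($\tau=\infty$ if there is none). Blockwise step sizes: let $\delta\in(0,1)$. For $k=0,1,2,\dots$ let $S_k=2^k$, $T_k=\sum_{j=0}^{k-1}S_j=2^k-1$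 ($T_0=0$), $\delta_k=\frac{6\delta}{\pi^2(k+1)^2}$ (here $\pi=3.14\ldots$), $\ell_k=\log(8nS_k/\delta_k)$, and $$\alpha_t=\alpha_{\rm sc}^{(k)}:=\min\left\{\frac1{4nL},\ \frac{\eta\varepsilon}{8\sqrt{nAF}\,L\,\ell_k}\right\},\qquad t\in\{T_k,\dots,T_k+S_k-1\},$$ where the second term is read as $+\infty$ if $F=0$. *)

(* Defs.v *)
From mathcomp Require Import all_boot all_order all_algebra all_fingroup.
From mathcomp Require Import all_classical all_reals all_analysis.
Set Implicit Arguments.
Unset Strict Implicit.
Unset Printing Implicit Defensive.
Import Order.TTheory GRing.Theory Num.Theory.
Import numFieldNormedType.Exports.
Local Open Scope classical_set_scope.
Local Open Scope ring_scope.

(* The norm `|x| that the library puts on 'rV[R]_d is the sup norm. *)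
Definition enorm (R : realType) (d : nat) (x : 'rV[R]_d) : R :=
  Num.sqrt (\sum_(i < d) x 0 i ^+ 2).

Definition gradient (R : realType) (d : nat) (f : 'rV[R]_d -> R)
    (x : 'rV[R]_d) : 'rV[R]_d :=
  \row_(i < d) 'D_(delta_mx 0 i) f x.

Definition continuously_differentiable (R : realType) (d : nat)
    (f : 'rV[R]_d -> R) : Prop :=
  (forall x, differentiable f x) /\ continuous (gradient f).

Definition gradient_lipschitz (R : realType) (d : nat) (L : R)
    (f : 'rV[R]_d -> R) : Prop :=
  forall x y, enorm (gradient f x - gradient f y) <= L * enorm (x - y).

Definition average (R : realType) (d n : nat) (f : 'I_n -> 'rV[R]_d -> R)
    (x : 'rV[R]_d) : R :=
  n%:R^-1 * \sum_(i < n) f i x.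

Definition constA (R : realType) (L : R) : R := 2 * L.

Definition constB (R : realType) (n : nat) (L fbar : R) (fibar : 'I_n -> R)
    : R :=
  constA L / n%:R * \sum_(i < n) (fbar - fibar i).

Definition constF (R : realType) (d n : nat) (f : 'I_n -> 'rV[R]_d -> R)
    (L fbar : R) (fibar : 'I_n -> R) (x0 : 'rV[R]_d) : R :=
  3 * (average f x0 - fbar) + 3 * constB L fbar fibar / constA L.

Definition block_size (k : nat) : nat := 2 ^ k.

Definition block_start (k : nat) : nat := \sum_(j < k) block_size j.

Definition block_delta (R : realType) (delta : R) (k : nat) : R :=
  6 * delta / (pi ^+ 2 * k.+1%:R ^+ 2).

Definition block_log (R : realType) (n : nat) (delta : R) (k : nat) : R :=
  ln (8 * n%:R * (block_size k)%:R / block_delta delta k).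

(* When F = 0 the second term of the minimum is read as +oo. *)
Definition block_stepsize (R : realType) (n : nat) (L F eta eps delta : R)
    (k : nat) : R :=
  let a := 1 / (4 * n%:R * L) in
  if F == 0 then a
  else Num.min a
    (eta * eps
     / (8 * Num.sqrt (n%:R * constA L * F) * L * block_log n delta k)).

(* Inner iterate x_t^i started at x, with 0 <= i <= n.  The i-th step
   (1 <= i <= n) uses the component s (i-1), the indices of 'I_n starting at 0;
   the branch None is only reached when i > n. *)
Fixpoint inner_iterate (R : realType) (d n : nat) (f : 'I_n -> 'rV[R]_d -> R)
    (alpha : R) (s : {perm 'I_n}) (x : 'rV[R]_d) (i : nat) : 'rV[R]_d :=
  if i is j.+1 then
    let y := inner_iterate f alpha s x j in
    if insub j is Some jn then y - alpha *: gradient (f (s jn)) y else y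
  else x.

Definition epoch_gradient (R : realType) (d n : nat)
    (f : 'I_n -> 'rV[R]_d -> R) (alpha : R) (s : {perm 'I_n}) (x : 'rV[R]_d)
    : 'rV[R]_d :=
  n%:R^-1 *: \sum_(i < n) gradient (f (s i)) (inner_iterate f alpha s x i).

(* The recursion is continued past the stopping epoch so as to be total: the
   method itself produces the iterates of index at most tau, where tau is
   rrsc_stopping_time below, and tau depends on these iterates only. *)
Fixpoint rrsc_iterate (R : realType) (d n : nat) (f : 'I_n -> 'rV[R]_d -> R)
    (alpha : nat -> R) (x0 : 'rV[R]_d) (s : nat -> {perm 'I_n}) (t : nat)
    : 'rV[R]_d :=
  if t is u.+1 then
    inner_iterate f (alpha u) (s u) (rrsc_iterate f alpha x0 s u) n
  else x0.

Definition rrsc_stop (R : realType) (d n : nat) (f : 'I_n -> 'rV[R]_d -> R)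
    (eta eps : R) (alpha : nat -> R) (x0 : 'rV[R]_d) (s : nat -> {perm 'I_n})
    (t : nat) : bool :=
  enorm (epoch_gradient f (alpha t) (s t) (rrsc_iterate f alpha x0 s t))
    <= eta * eps.

Definition first_time (R : realType) (stop : nat -> bool) : \bar R :=
  if pselect (exists t, stop t) is left ex_stop
  then (ex_minn ex_stop)%:R%:E else +oo%E.

Definition rrsc_stopping_time (R : realType) (d n : nat)
    (f : 'I_n -> 'rV[R]_d -> R) (eta eps : R) (alpha : nat -> R)
    (x0 : 'rV[R]_d) (s : nat -> {perm 'I_n}) : \bar R :=
  first_time R (rrsc_stop f eta eps alpha x0 s).

(* The finite type {perm 'I_n} carries the discrete sigma-algebra. *)
Definition random_permutation (d : measure_display) (Omega : measurableType d)
    (n : nat) (p : Omega -> {perm 'I_n}) : Prop :=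
  forall A : set {perm 'I_n}, measurable (p @^-1` A).

Definition uniform_permutation (R : realType) (d : measure_display)
    (Omega : measurableType d) (P : probability Omega R) (n : nat)
    (p : Omega -> {perm 'I_n}) : Prop :=
  forall s : {perm 'I_n}, P (p @^-1` [set s]) = (#|{perm 'I_n}|%:R^-1)%:E.

(* The sets [set w | forall u, (u < t)%N -> B u (p u w)] form a pi-system
   generating the sigma-algebra of the variables p u with u < t. *)
Definition independent_of_past (R : realType) (d : measure_display)
    (Omega : measurableType d) (P : probability Omega R) (n : nat)
    (p : nat -> Omega -> {perm 'I_n}) : Prop :=
  forall (t : nat) (A : set {perm 'I_n}) (B : nat -> set {perm 'I_n}),
    let past := [set w | forall u, (u < t)%N -> B u (p u w)] in
    P (p t @^-1` A `&` past) = (P (p t @^-1` A) * P past)%E.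

(* Main.v *)
(** Write [V] for the sum over the components of the squared deviations of
    their gradients at [x] from the mean gradient.  For the partial sums [S] of
    these deviations along a random permutation, the swap of two positions is an
    exchangeable pair, which gives [E |S|^(2m+2) <= 4 (m+1) V E |S|^(2m)] and by
    Markov's inequality a dimension-free tail
    [P (|S|^2 > 24 V l^2) <= exp (- l)]; a union bound covers the [n] partial
    sums of an epoch and all epochs.  Off the exceptional event the epoch
    gradient is so close to the mean gradient that the descent lemma yields the
    claimed decrease, provided [3 V <= n A F]; this holds as long as the values
    of [f] stay below [f x0], because [|grad f_i|^2 <= 2 L (f_i - inf f_i)].
    The decrease cannot go on once it would exceed [f x0 - fbar]. *)
Require Import Defs.
From mathcomp Require Import all_boot all_order all_algebra all_fingroup.
From mathcomp Require Import all_classical all_reals all_analysis.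
From mathcomp Require Import ring lra.
Set Implicit Arguments.
Unset Strict Implicit.
Unset Printing Implicit Defensive.
Import Order.TTheory GRing.Theory Num.Theory.
Import numFieldNormedType.Exports.
Local Open Scope classical_set_scope.
Local Open Scope ring_scope.

(** * Euclidean inner product and norm on row vectors *)

Definition dot (R : realType) (d : nat) (x y : 'rV[R]_d) : R :=
  \sum_(i < d) x 0 i * y 0 i.

Section EuclideanSpace.
Variables (R : realType) (d : nat).
Implicit Types (x y z : 'rV[R]_d) (a b : R).

Lemma dotC x y : dot x y = dot y x.
Proof. by apply: eq_bigr => i _; rewrite mulrC. Qed.

Lemma dotDl x y z : dot (x + y) z = dot x z + dot y z.
Proof. by rewrite -big_split; apply: eq_bigr => i _; rewrite mxE mulrDl. Qed.

Lemma dotDr x y z : dot z (x + y) = dot z x + dot z y.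
Proof. by rewrite dotC dotDl !(dotC z). Qed.

Lemma dotZl a x y : dot (a *: x) y = a * dot x y.
Proof. by rewrite mulr_sumr; apply: eq_bigr => i _; rewrite mxE mulrA. Qed.

Lemma dotZr a x y : dot x (a *: y) = a * dot x y.
Proof. by rewrite dotC dotZl dotC. Qed.

Lemma dotNl x y : dot (- x) y = - dot x y.
Proof. by rewrite -scaleN1r dotZl mulN1r. Qed.

Lemma dotNr x y : dot x (- y) = - dot x y.
Proof. by rewrite dotC dotNl dotC. Qed.

Lemma dotBl x y z : dot (x - y) z = dot x z - dot y z.
Proof. by rewrite dotDl dotNl. Qed.

Lemma dotBr x y z : dot z (x - y) = dot z x - dot z y.
Proof. by rewrite dotDr dotNr. Qed.

Lemma dot0l x : dot 0 x = 0.
Proof. by rewrite -(scale0r x) dotZl mul0r. Qed.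

Lemma dot_suml I (r : seq I) (P : pred I) (F : I -> 'rV[R]_d) y :
  dot (\sum_(i <- r | P i) F i) y = \sum_(i <- r | P i) dot (F i) y.
Proof. by elim/big_rec2: _ => [|i a z _ <-]; rewrite ?dot0l ?dotDl. Qed.

Lemma dot_ge0 x : 0 <= dot x x.
Proof. by apply: sumr_ge0 => i _; rewrite -expr2 sqr_ge0. Qed.

Lemma dot_eq0 x : dot x x = 0 -> x = 0.
Proof.
move/eqP; rewrite psumr_eq0 => [/allP x0|i _]; last by rewrite -expr2 sqr_ge0.
apply/rowP => i; have := x0 i (mem_index_enum _).
by rewrite -expr2 sqrf_eq0 mxE => /eqP.
Qed.

Lemma cauchy_schwarz x y : dot x y ^+ 2 <= dot x x * dot y y.
Proof.
have [y0|yn0] := eqVneq (dot y y) 0.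
  by rewrite (dot_eq0 y0) !(dotC _ 0) !dot0l mulr0 expr0n.
have ygt0 : 0 < dot y y by rewrite lt_def yn0 dot_ge0.
(* The squared norm of this vector is [dot y y] times the gap to be shown nonnegative. *)
have := dot_ge0 (dot y y *: x - dot x y *: y).
rewrite !(dotBl, dotBr, dotZl, dotZr) (dotC y x) => h.
rewrite -subr_ge0 -(pmulr_rge0 _ ygt0); apply: le_trans h _.
by rewrite le_eqVlt; apply/orP; left; apply/eqP; ring.
Qed.

Lemma enormE x : enorm x = Num.sqrt (dot x x).
Proof. by congr Num.sqrt; apply: eq_bigr => i _; rewrite expr2. Qed.

Lemma sqr_enorm x : enorm x ^+ 2 = dot x x.
Proof. by rewrite enormE sqr_sqrtr ?dot_ge0. Qed.

Lemma enorm_ge0 x : 0 <= enorm x.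
Proof. by rewrite sqrtr_ge0. Qed.

Lemma enormZ a x : enorm (a *: x) = `|a| * enorm x.
Proof.
by rewrite !enormE dotZl dotZr mulrA -expr2 sqrtrM ?sqr_ge0 // sqrtr_sqr.
Qed.

Lemma enormN x : enorm (- x) = enorm x.
Proof. by rewrite -scaleN1r enormZ normrN normr1 mul1r. Qed.

Lemma enorm0 : enorm (0 : 'rV[R]_d) = 0.
Proof. by rewrite enormE dot0l sqrtr0. Qed.

Lemma dot_le_enorm x y : dot x y <= enorm x * enorm y.
Proof.
apply: le_trans (ler_norm _) _.
rewrite -(@ler_pXn2r _ 2) ?nnegrE ?mulr_ge0 ?enorm_ge0 //.
by rewrite real_normK ?num_real // exprMn !sqr_enorm cauchy_schwarz.
Qed.

Lemma enormD x y : enorm (x + y) <= enorm x + enorm y.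
Proof.
rewrite -(@ler_pXn2r _ 2) ?nnegrE ?addr_ge0 ?enorm_ge0 //.
rewrite sqr_enorm sqrrD !sqr_enorm !(dotDl, dotDr) (dotC y x).
have := dot_le_enorm x y; lra.
Qed.

Lemma enorm_sum I (r : seq I) (P : pred I) (F : I -> 'rV[R]_d) :
  enorm (\sum_(i <- r | P i) F i) <= \sum_(i <- r | P i) enorm (F i).
Proof.
elim/big_rec2: _ => [|i a z _ h]; first by rewrite enorm0.
by apply: le_trans (enormD _ _) _; rewrite lerD2l.
Qed.

Lemma dotD_le x y : dot (x + y) (x + y) <= 2 * (dot x x + dot y y).
Proof.
have := dot_ge0 (x - y).
by rewrite !(dotDl, dotDr, dotNl, dotNr) (dotC y x); lra.
Qed.

End EuclideanSpace.

(** * Smoothness: directional derivatives, descent lemma, gradient bound *)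

Section DescentLemma.
Variables (R : realType) (d : nat) (f : 'rV[R]_d -> R) (L : R).
Hypothesis f_diff : forall x, differentiable f x.
Hypothesis L_gt0 : 0 < L.
Hypothesis f_lip : gradient_lipschitz L f.
Implicit Types x h : 'rV[R]_d.

Lemma derive_dot_gradient x h : 'D_h f x = dot (gradient f x) h.
Proof.
rewrite deriveE // {1}(row_sum_delta h) linear_sum; apply: eq_bigr => i _.
by rewrite linearZ /= mxE deriveE // mulrC.
Qed.

Lemma is_derive_line x h (t : R) :
  is_derive t 1 (fun s : R => f (x + s *: h)) (dot (gradient f (x + t *: h)) h).
Proof.
(* The difference quotients of the restriction to the line at [t] are those of [f] at [x + t h] in
   the direction [h]. *)
have quotE : (fun s : R => s^-1 *: (f (x + (s *: (1 : R) + t) *: h) - f (x + t *: h)))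
    = (fun s : R => s^-1 *: (f (s *: h + (x + t *: h)) - f (x + t *: h))).
  apply/funext => s; congr (_ *: (f _ - _)).
  by rewrite [s *: 1]mulr1 scalerDl addrCA.
rewrite -derive_dot_gradient; split; last by rewrite /derive /= quotE.
rewrite /derivable /= quotE.
exact: (diff_derivable (f_diff (x + t *: h))).
Qed.

(* The map below has derivative
   [<grad f (x + s h) - grad f x, h> - L s |h|^2 <= 0] on [0, 1]. *)
Lemma descent_lemma x h :
  f (x + h) <= f x + dot (gradient f x) h + L / 2 * dot h h.
Proof.
pose c := dot (gradient f x) h.
pose g (s : R) := f (x + s *: h) + (s * (- c) + s ^+ 2 * (- (L / 2 * dot h h))).
have dg (s : R) : is_derive s 1 g
   (dot (gradient f (x + s *: h)) h + (- c - L * s * dot h h)).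
  apply: is_deriveD; first exact: is_derive_line.
  by apply: is_derive_eq; rewrite /= /GRing.scale /=; field.
have gcont : {within `[0 : R, 1], continuous g}.
  apply: continuous_subspaceT => u; apply: differentiable_continuous.
  by apply/derivable1_diffP; case: (dg u).
have : g 1 <= g 0.
  apply: (@ler0_derive1_le_cc R g 0 1) => //; rewrite ?in_itv /= ?lexx ?ler01 //.
  move=> s; rewrite in_itv /= => /andP[s0 s1].
  rewrite derive1E; case: (dg s) => _ ->.
  have : dot (gradient f (x + s *: h) - gradient f x) h <= L * s * dot h h.
    apply: le_trans (dot_le_enorm _ _) _.
    rewrite -sqr_enorm expr2 mulrA ler_wpM2r ?enorm_ge0 //.
    apply: le_trans (f_lip _ _) _.
    by rewrite [x + _]addrC addrK enormZ ger0_norm ?mulrA // ltW.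
  by rewrite dotBl -/c; lra.
rewrite /g scale1r scale0r addr0 expr0n expr1n !mul0r !mul1r addr0.
by rewrite -/c; lra.
Qed.

(** A gradient step of length [1 / L] lowers [f] by at least [|grad f x|^2 / (2 L)], and the value
    reached is still at least [m]. *)
Lemma sqr_gradient_le m x :
  (forall y, m <= f y) -> dot (gradient f x) (gradient f x) <= 2 * L * (f x - m).
Proof.
move=> fm; have := descent_lemma x (- (L^-1 *: gradient f x)).
have := fm (x - L^-1 *: gradient f x).
rewrite !(dotNl, dotNr, dotZl, dotZr).
set q := dot _ _; set y := f (x - _) => my.
have -> : f x - L^-1 * q + L / 2 * - - (L^-1 * (L^-1 * q)) = f x - q / (2 * L).
  by field; rewrite gt_eqF.
move=> h; have {h my}: q / (2 * L) <= f x - m by lra.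
by rewrite ler_pdivrMr ?mulr_gt0 // mulrC.
Qed.

End DescentLemma.

(** * Sampling without replacement: moments and tails of partial sums *)

Section SamplingWithoutReplacement.
Variables (R : realType) (d n : nat) (u : 'I_n -> 'rV[R]_d) (J : pred 'I_n).
Hypothesis u_sum0 : \sum_(i < n) u i = 0.
Implicit Types s : {perm 'I_n}.

Let S s : 'rV[R]_d := \sum_(j < n | J j) u (s j).
Let q s : R := dot (S s) (S s).
Let w j k s : 'rV[R]_d := u (s j) - u (s k).
Let V : R := \sum_(i < n) dot (u i) (u i).

(** The left factor of a permutation product acts first, so the positions [j] and [k] are exchanged,
    of which only [j] lies in [J]. *)
Let S_swap j k s : J j -> ~~ J k -> S (tperm j k * s)%g = S s - w j k s.
Proof.
move=> Jj Jk; rewrite /S /w (bigD1 j) //= [in RHS](bigD1 j) //= permM tpermL.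
have -> : \sum_(i < n | J i && (i != j)) u ((tperm j k * s)%g i)
    = \sum_(i < n | J i && (i != j)) u (s i).
  apply: eq_bigr => i /andP[Ji ij]; rewrite permM tpermD // 1?eq_sym //.
  by apply: contraNneq Jk => <-.
by rewrite opprB [RHS]addrC addrA subrK.
Qed.

Let w_swap j k s : w j k (tperm j k * s)%g = - w j k s.
Proof. by rewrite /w !permM tpermL tpermR opprB. Qed.

Let sum_perm_swap j k (G : {perm 'I_n} -> R) :
  \sum_s G (tperm j k * s)%g = \sum_s G s.
Proof. by rewrite [RHS](reindex_inj (mulgI (tperm j k))). Qed.

Let sum_const (M : zmodType) (Q : pred 'I_n) (x : M) :
  \sum_(j < n | Q j) x = x *+ #|Q|.
Proof. exact: (sumr_const Q x). Qed.

(** Since the [u i] sum to zero, the values outside [J] sum to [- S s]; the double sum thus counts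
    [S s] once per position outside [J] and once per position inside, [n] times in all. *)
Let pair_sum s :
  \sum_(j < n | J j) \sum_(k < n | ~~ J k) w j k s = n%:R *: S s.
Proof.
have S_compl : \sum_(k < n | ~~ J k) u (s k) = - S s.
  apply/eqP; rewrite -addr_eq0 addrC; apply/eqP.
  by rewrite -[RHS]u_sum0 [RHS](reindex_inj (@perm_inj _ s)) /= [RHS](bigID J).
under eq_bigr => j _ do rewrite /w sumrB S_compl opprK sum_const.
rewrite big_split /= sum_const sumrMnl.
rewrite -mulrnDr addnC scaler_nat; congr (_ *+ _).
by rewrite -[RHS](card_ord n) -(cardC J).
Qed.

Let pair_sqr_sum s :
  \sum_(j < n | J j) \sum_(k < n | ~~ J k) dot (w j k s) (w j k s)
  <= 2 * n%:R * V.
Proof.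
pose v i := dot (u (s i)) (u (s i)).
have VE : V = \sum_(j < n | J j) v j + \sum_(k < n | ~~ J k) v k.
  by rewrite /V (reindex_inj (@perm_inj _ s)) (bigID J).
have v_ge0 (Q : pred 'I_n) : 0 <= \sum_(j < n | Q j) v j.
  by apply: sumr_ge0 => i _; exact: dot_ge0.
apply: (@le_trans _ _
   (\sum_(j < n | J j) \sum_(k < n | ~~ J k) 2 * (v j + v k))).
  apply: ler_sum => j _; apply: ler_sum => k _.
  by rewrite /w (le_trans (dotD_le _ _)) // dotNl dotNr opprK.
under eq_bigr => j _ do rewrite -mulr_sumr big_split /= sum_const.
rewrite -mulr_sumr big_split /= sum_const sumrMnl -mulrA ler_wpM2l //.
rewrite -[_ *+ #|_|]mulr_natl -[X in _ + X]mulr_natl VE mulrDr.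
by apply: lerD; rewrite ler_wpM2r // ler_nat -[leqRHS](card_ord n) max_card.
Qed.

(** This is [A^m - B^m <= m A^(m-1) (A - B)] multiplied by [A - B], arranged so that neither a
    division by [A] nor the exponent [m - 1] occurs. *)
Let sub_expn_le (A B c : R) m : 0 <= B -> B <= A -> (A - B) ^+ 2 <= c * A ->
  (A ^+ m - B ^+ m) * (A - B) <= m%:R * c * A ^+ m.
Proof.
move=> B0 BA h; have A0 := le_trans B0 BA.
elim: m => [|m IH]; first by rewrite !expr0 subrr !mul0r.
have -> : (A ^+ m.+1 - B ^+ m.+1) * (A - B)
    = A * ((A ^+ m - B ^+ m) * (A - B)) + B ^+ m * (A - B) ^+ 2.
  by rewrite !exprS; ring.
have h1 : A * ((A ^+ m - B ^+ m) * (A - B)) <= A * (m%:R * c * A ^+ m).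
  exact: ler_wpM2l.
have h2 : B ^+ m * (A - B) ^+ 2 <= A ^+ m * (c * A).
  apply: ler_pM => //; [exact: exprn_ge0|exact: sqr_ge0|].
    by apply: lerXn2r; rewrite ?nnegrE.
apply: le_trans (lerD h1 h2) _.
by rewrite exprS -natr1 le_eqVlt; apply/orP; left; apply/eqP; ring.
Qed.

(** The map [x -> |x|^(2m) x] is the gradient of [|x|^(2m+2) / (2m+2)]; its increment along [x - y]
    splits into a multiple of [|x - y|^2] and the product bounded by [sub_expn_le]. *)
Let power_gradient_monotone (x y : 'rV[R]_d) m :
  dot (x - y) (dot x x ^+ m *: x - dot y y ^+ m *: y)
    <= 2 * m.+1%:R * dot (x - y) (x - y) * (dot x x ^+ m + dot y y ^+ m).
Proof.
wlog BA : x y / dot y y <= dot x x => [hw|].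
  have [|AB] := leP (dot y y) (dot x x); first exact: hw.
  have := hw y x (ltW AB).
  rewrite -opprB -[_ *: y - _]opprB !(dotNl, dotNr) !opprK.
  by rewrite [dot y y ^+ m + _]addrC.
move: BA; set A := dot x x; set B := dot y y; set z := x - y => BA.
have A0 : 0 <= A := dot_ge0 x.
have B0 : 0 <= B := dot_ge0 y.
have z0 : 0 <= dot z z := dot_ge0 z.
have splitE : dot z (A ^+ m *: x - B ^+ m *: y)
   = (A ^+ m + B ^+ m) * dot z z / 2 + (A ^+ m - B ^+ m) * (A - B) / 2.
  by rewrite /A /B /z !(dotBl, dotBr, dotZr) (dotC y x); field.
have diffE : A - B = dot z (x + y).
  by rewrite /A /B /z !(dotBl, dotDr) (dotC y x); ring.
(* Here [c = 4 |x - y|^2] is admissible: [A - B = <x - y, x + y>] and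
   [|x + y|^2 <= 2 (A + B) <= 4 A]. *)
have : (A ^+ m - B ^+ m) * (A - B) <= m%:R * (4 * dot z z) * A ^+ m.
  apply: sub_expn_le => //; rewrite diffE.
  apply: le_trans (cauchy_schwarz _ _) _.
  rewrite (mulrC 4) -mulrA ler_wpM2l //.
  apply: le_trans (dotD_le _ _) _; rewrite -/A -/B; lra.
have : 0 <= dot z z * A ^+ m by rewrite mulr_ge0 ?exprn_ge0.
have : 0 <= dot z z * B ^+ m by rewrite mulr_ge0 ?exprn_ge0.
have : 0 <= m%:R * (dot z z * B ^+ m) by rewrite !mulr_ge0 ?exprn_ge0.
rewrite splitE -natr1; lra.
Qed.

(** Averaged with its image under the swap, the left side becomes half the increment of
    [x -> |x|^(2m) x] between [S s - w] and [S s], taken along [w]. *)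
Let dot_w_moment j k m : J j -> ~~ J k ->
  \sum_s dot (w j k s) (S s) * q s ^+ m
    <= 2 * m.+1%:R * \sum_s dot (w j k s) (w j k s) * q s ^+ m.
Proof.
move=> Jj Jk; set X := \sum_s _; set Y := \sum_s _.
have XE : X + X = \sum_s dot (w j k s)
    (q s ^+ m *: S s - q (tperm j k * s)%g ^+ m *: S (tperm j k * s)%g).
  rewrite {2}/X -(sum_perm_swap j k (fun s => dot _ (S s) * _)) -big_split.
  apply: eq_bigr => s _ /=.
  by rewrite dotBr !dotZr w_swap dotNl; ring.
have YE : 4 * m.+1%:R * Y = \sum_s 2 * m.+1%:R * dot (w j k s) (w j k s)
     * (q s ^+ m + q (tperm j k * s)%g ^+ m).
  have -> : 4 * m.+1%:R * Y = 2 * m.+1%:R * (Y + Y) by ring.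
  rewrite {2}/Y -(sum_perm_swap j k (fun s => dot _ (w j k s) * _)).
  rewrite -big_split mulr_sumr.
  by apply: eq_bigr => s _ /=; rewrite w_swap dotNl dotNr opprK; ring.
have : X + X <= 4 * m.+1%:R * Y.
  rewrite XE YE; apply: ler_sum => s _.
  have := power_gradient_monotone (S s) (S (tperm j k * s)%g) m.
  by rewrite -/(q _) -/(q _) S_swap // opprB [S s + _]addrC subrK.
lra.
Qed.

(* Exchangeability: [n S] is the sum of the differences [w j k s] over
   [j] in [J] and [k] outside [J], and swapping the values at [j] and [k]
   preserves the uniform law, flips [w j k s] and changes [S] by [w j k s]. *)
Lemma moment_partial_sum_step m : (0 < n)%N ->
  \sum_s q s ^+ m.+1 <= 4 * m.+1%:R * V * \sum_s q s ^+ m.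
Proof.
move=> n0; have n0' : 0 < n%:R :> R by rewrite ltr0n.
rewrite -(ler_pM2l n0').
have -> : n%:R * \sum_s q s ^+ m.+1 = \sum_(j < n | J j) \sum_(k < n | ~~ J k)
    \sum_s dot (w j k s) (S s) * q s ^+ m.
  under [RHS]eq_bigr => j _ do rewrite exchange_big /=.
  rewrite [RHS]exchange_big /= mulr_sumr; apply: eq_bigr => s _.
  under [RHS]eq_bigr => j _ do rewrite -mulr_suml -dot_suml.
  by rewrite -mulr_suml -dot_suml pair_sum dotZl exprS mulrA.
apply: (@le_trans _ _ (\sum_(j < n | J j) \sum_(k < n | ~~ J k)
    2 * m.+1%:R * \sum_s dot (w j k s) (w j k s) * q s ^+ m)).
  by apply: ler_sum => j Jj; apply: ler_sum => k Jk; exact: dot_w_moment.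
under eq_bigr => j _ do rewrite -mulr_sumr exchange_big /=.
rewrite -mulr_sumr exchange_big /=.
have -> : n%:R * (4 * m.+1%:R * V * \sum_s q s ^+ m)
    = 2 * m.+1%:R * \sum_s 2 * n%:R * V * q s ^+ m.
  by rewrite -mulr_sumr; ring.
rewrite ler_wpM2l //; apply: ler_sum => s _.
under eq_bigr => j _ do rewrite -mulr_suml.
by rewrite -mulr_suml ler_wpM2r ?exprn_ge0 ?dot_ge0.
Qed.

(** Iterating the step would give [4^m m! V^m]; bounding [m!] by [m^m] leaves a single power,
    convenient for Markov's inequality. *)
Lemma moment_partial_sum m : (0 < n)%N ->
  \sum_s q s ^+ m <= #|{perm 'I_n}|%:R * (4 * m%:R * V) ^+ m.
Proof.
move=> n0; have V0 : 0 <= V by apply: sumr_ge0 => i _; exact: dot_ge0.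
elim: m => [|m IH].
  under eq_bigr do rewrite expr0.
  by rewrite expr0 mulr1 sumr_const.
apply: le_trans (moment_partial_sum_step m n0) _.
rewrite [in leRHS]exprS mulrCA ler_wpM2l ?mulr_ge0 //.
apply: le_trans IH _; rewrite ler_wpM2l // lerXn2r ?nnegrE ?mulr_ge0 //.
by rewrite ler_wpM2r // ler_wpM2l // ler_nat.
Qed.

(* Markov's inequality for the moment of order [m ~ l]: the ratio
   [4 m V / (24 V l^2)] is at most [1 / (3 l) <= 1 / 4 <= exp (- 1)]. *)
Lemma tail_partial_sum (l : R) : (0 < n)%N -> 4 / 3 <= l ->
  #|[pred s | 24 * V * l ^+ 2 < q s]|%:R <= #|{perm 'I_n}|%:R * expR (- l).
Proof.
move=> n0 l43; have V0 : 0 <= V by apply: sumr_ge0 => i _; exact: dot_ge0.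
(* If [V = 0], all [u i] vanish and the strict inequality selects no permutation; otherwise the
   threshold is positive and its powers can be cancelled. *)
have [Veq0|Vn0] := eqVneq V 0.
  have u0 i : u i = 0.
    apply: dot_eq0; move/eqP: Veq0; rewrite psumr_eq0 => [/allP h|j _].
      exact/eqP/h/mem_index_enum.
    exact: dot_ge0.
  rewrite (_ : #|_| = 0)%N ?mulr_ge0 ?expR_ge0 //.
  apply: eq_card0 => s; rewrite !inE Veq0 mulr0 mul0r /q /S big1 ?dot0l ?ltxx //.
have Vgt0 : 0 < V by rewrite lt_def Vn0.
pose m := (Num.trunc l).+1.
have l0 : 0 <= l by lra.
have /andP[ml lm] := trunc_itv l0.
have {}lm : l <= m%:R by exact: ltW.
have {}ml : m%:R <= 2 * l.
  by rewrite /m -natr1; lra.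
set T := 24 * V * l ^+ 2.
have T0 : 0 < T by rewrite !mulr_gt0 //; lra.
have card_le : #|[pred s | T < q s]|%:R * T ^+ m <= \sum_s q s ^+ m.
  rewrite -sum1_card natr_sum mulr_suml [leRHS](bigID (fun s => T < q s)) /=.
  rewrite -[leLHS]addr0; apply: lerD.
    apply: ler_sum => s /= Ts; rewrite mul1r lerXn2r ?nnegrE ?dot_ge0 //; exact: ltW.
  by apply: sumr_ge0 => s _; rewrite exprn_ge0 ?dot_ge0.
rewrite -(@ler_pM2r _ (T ^+ m)) ?exprn_gt0 //.
apply: le_trans card_le _; apply: le_trans (moment_partial_sum m n0) _.
rewrite -[leRHS]mulrA ler_wpM2l //.
apply: (@le_trans _ _ ((expR (-1) * T) ^+ m)).
  rewrite lerXn2r ?nnegrE ?mulr_ge0 ?expR_ge0 ?(ltW T0) //.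
  (* [exp (- 1)] is the square of [exp (- 1 / 2)], which is at least [1 - 1 / 2]. *)
  have e4 : 4^-1 <= expR (-1) :> R.
    have -> : -1 = 2%:R * (- 2^-1) :> R by field.
    rewrite expRM_natl; have := expR_ge1Dx (- 2^-1 : R) => h.
    have : (2^-1) ^+ 2 <= expR (- 2^-1) ^+ 2 :> R.
      by rewrite lerXn2r ?nnegrE ?expR_ge0 //; lra.
    by apply: le_trans; lra.
  apply: (@le_trans _ _ (4^-1 * T)); last by rewrite ler_wpM2r // ltW.
  have : m%:R * V <= 2 * l * V by rewrite ler_wpM2r.
  have : (l * V) * (4 / 3) <= (l * V) * l by rewrite ler_wpM2l ?mulr_ge0.
  rewrite /T; lra.
rewrite exprMn -expRM_natl mulrN1 ler_wpM2r ?exprn_ge0 ?(ltW T0) //.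
by rewrite ler_expR lerN2.
Qed.

End SamplingWithoutReplacement.

(** * Mean gradient and dispersion of the component gradients *)

Section Epoch.
Variables (R : realType) (d n : nat) (f : 'I_n -> 'rV[R]_d -> R) (L : R).
Hypothesis n_gt0 : (0 < n)%N.
Hypothesis f_diff : forall i x, differentiable (f i) x.
Hypothesis L_gt0 : 0 < L.
Hypothesis f_lip : forall i, gradient_lipschitz L (f i).
Implicit Types (x : 'rV[R]_d) (s : {perm 'I_n}).

Definition mean_gradient x : 'rV[R]_d :=
  n%:R^-1 *: \sum_(i < n) gradient (f i) x.

Definition gradient_dev x (i : 'I_n) : 'rV[R]_d :=
  gradient (f i) x - mean_gradient x.

Definition gradient_dispersion x : R :=
  \sum_(i < n) dot (gradient_dev x i) (gradient_dev x i).

Let n_neq0 : n%:R != 0 :> R.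
Proof. by rewrite pnatr_eq0 -lt0n. Qed.

Let sum_gradient x :
  \sum_(i < n) gradient (f i) x = n%:R *: mean_gradient x.
Proof. by rewrite scalerA divff // scale1r. Qed.

Lemma sum_gradient_dev x : \sum_(i < n) gradient_dev x i = 0.
Proof.
by rewrite sumrB sum_gradient sumr_const card_ord scaler_nat subrr.
Qed.

(** A variance is at most the second moment, and each [|grad f_i|^2] is controlled by the height of
    [f i] above its lower bound. *)
Lemma gradient_dispersion_le (m : 'I_n -> R) x : (forall i y, m i <= f i y) ->
  gradient_dispersion x <= 2 * L * (n%:R * average f x - \sum_(i < n) m i).
Proof.
move=> fm; apply: (@le_trans _ _
    (\sum_(i < n) dot (gradient (f i) x) (gradient (f i) x))).
  have -> : gradient_dispersion x
      = \sum_(i < n) dot (gradient (f i) x) (gradient (f i) x)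
        - n%:R * dot (mean_gradient x) (mean_gradient x).
    rewrite -dotZl -sum_gradient dot_suml -sumrB.
    have : \sum_(i < n) dot (gradient_dev x i) (mean_gradient x) = 0.
      by rewrite -dot_suml sum_gradient_dev dot0l.
    move=> dev0; rewrite -[RHS]subr0 -[X in _ = _ - X]dev0 -sumrB; apply: eq_bigr => i _.
    by rewrite !(dotBl, dotBr) (dotC (mean_gradient x)); ring.
  by rewrite gerBl mulr_ge0 ?dot_ge0.
rewrite mulrA divff // mul1r -sumrB mulr_sumr.
by apply: ler_sum => i _; apply: sqr_gradient_le.
Qed.

Lemma average_descent x h :
  average f (x + h) <= average f x + dot (mean_gradient x) h + L / 2 * dot h h.
Proof.
have n0 : 0 < n%:R :> R by rewrite ltr0n.
rewrite -(ler_pM2l n0) !mulrDr {1 2}/average !mulrA divff // !mul1r.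
rewrite -dotZl -sum_gradient dot_suml -big_split /=.
have -> : n%:R * L / 2 * dot h h = \sum_(i < n) L / 2 * dot h h.
  by rewrite sumr_const card_ord -!mulrA mulr_natl.
rewrite -big_split /=; apply: ler_sum => i _.
exact: descent_lemma.
Qed.

(** * Inner loop of one epoch: drift, gradient error and decrease *)

Section InnerLoop.
Variables (alpha : R) (s : {perm 'I_n}) (x : 'rV[R]_d).
Let y := inner_iterate f alpha s x.

Lemma inner_iterate_sum i : (i <= n)%N ->
  y i = x - alpha *: \sum_(j < n | (j < i)%N) gradient (f (s j)) (y j).
Proof.
elim: i => [_|i IH lt_in].
  by rewrite big_pred0 ?scaler0 ?subr0.
rewrite /y /= (insubT (fun j => (j < n)%N) lt_in) -/(y i) {1}IH ?(ltnW lt_in) //.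
rewrite [in RHS](bigD1 (Ordinal lt_in)) //= scalerDr opprD addrA addrAC.
congr (_ - _ *: _ - _); apply: eq_bigl => j.
by rewrite ltnS ltn_neqAle andbC -(inj_eq val_inj).
Qed.

Lemma inner_iterate_last : y n = x - (alpha * n%:R) *: epoch_gradient f alpha s x.
Proof.
rewrite inner_iterate_sum // scalerA mulfK //.
by congr (_ - _ *: _); apply: eq_bigl => j; rewrite ltn_ord.
Qed.

Variable M : R.
Hypothesis alpha_gt0 : 0 < alpha.
Hypothesis alpha_le : 4 * (alpha * n%:R * L) <= 1.
Hypothesis M_bound : forall i, (i < n)%N ->
  enorm (\sum_(j < n | (j < i)%N) gradient_dev x (s j)) <= M.

(** Fixed point of the drift recursion [D = D / 4 + alpha M + alpha n |mean_gradient x|], where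
    [1 / 4] bounds [alpha n L]. *)
Let D : R := 4 / 3 * (alpha * M + alpha * n%:R * enorm (mean_gradient x)).

Let sum_const_le (Q : pred 'I_n) (c : R) :
  0 <= c -> \sum_(j < n | Q j) c <= n%:R * c.
Proof.
move=> c0; rewrite mulr_natl -[in leRHS](card_ord n) -sumr_const.
by rewrite [leRHS](bigID Q) /= lerDl sumr_ge0.
Qed.

Let M_ge0 : 0 <= M.
Proof. by apply: le_trans (M_bound n_gt0); rewrite enorm_ge0. Qed.

Let D_ge0 : 0 <= D.
Proof.
by rewrite /D !(mulr_ge0, addr_ge0) ?enorm_ge0 ?(ltW alpha_gt0).
Qed.

Lemma inner_iterate_dist i : (i < n)%N -> enorm (y i - x) <= D.
Proof.
elim/ltn_ind: i => i IH lt_in.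
rewrite inner_iterate_sum ?(ltnW lt_in) // addrAC subrr add0r enormN enormZ.
rewrite (gtr0_norm alpha_gt0).
pose e (j : 'I_n) := gradient (f (s j)) (y j) - gradient (f (s j)) x.
(* Each gradient splits into a Lipschitz error (induction hypothesis), the deviation at [x] (bounded
   by [M] in sum) and the mean. *)
have -> : \sum_(j < n | (j < i)%N) gradient (f (s j)) (y j)
    = \sum_(j < n | (j < i)%N) e j
      + \sum_(j < n | (j < i)%N) gradient_dev x (s j)
      + \sum_(j < n | (j < i)%N) mean_gradient x.
  rewrite -!big_split /=; apply: eq_bigr => j _.
  by rewrite /e /gradient_dev addrA subrK subrK.
have he : enorm (\sum_(j < n | (j < i)%N) e j) <= n%:R * (L * D).
  apply: le_trans (enorm_sum _ _ _) _.
  apply: le_trans (sum_const_le (fun j : 'I_n => (j < i)%N) _); last first.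
    by rewrite mulr_ge0 // ltW.
  apply: ler_sum => j ji; apply: le_trans (f_lip _ _ _) _.
  by rewrite ler_wpM2l ?(ltW L_gt0) // IH // (ltn_trans ji).
have hm : enorm (\sum_(j < n | (j < i)%N) mean_gradient x)
    <= n%:R * enorm (mean_gradient x).
  by apply: le_trans (enorm_sum _ _ _) _; apply/sum_const_le/enorm_ge0.
have h : enorm (\sum_(j < n | (j < i)%N) e j
      + \sum_(j < n | (j < i)%N) gradient_dev x (s j)
      + \sum_(j < n | (j < i)%N) mean_gradient x)
    <= n%:R * (L * D) + M + n%:R * enorm (mean_gradient x).
  apply: le_trans (enormD _ _) _; apply: lerD => //.
  by apply: le_trans (enormD _ _) _; apply: lerD => //; exact: M_bound.
apply: le_trans (ler_wpM2l (ltW alpha_gt0) h) _.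
have : 4 * (alpha * n%:R * L) * D <= 1 * D by rewrite ler_wpM2r.
rewrite /D; lra.
Qed.

(** The error is a mean of gradient differences of norm at most [L D], and [alpha n L <= 1 / 4]
    turns [4 / 3 * alpha n L] into [1 / 3]. *)
Lemma epoch_gradient_error :
  enorm (epoch_gradient f alpha s x - mean_gradient x)
    <= enorm (mean_gradient x) / 3 + 4 / 3 * (alpha * L * M).
Proof.
have n0 : 0 < n%:R :> R by rewrite ltr0n.
have sumE : \sum_(i < n) gradient (f i) x = \sum_(i < n) gradient (f (s i)) x.
  by rewrite (reindex_inj (@perm_inj _ s)).
rewrite /epoch_gradient {1}/mean_gradient sumE.
rewrite -scalerBr -sumrB enormZ ger0_norm ?invr_ge0 // mulrC ler_pdivrMr //.
apply: (@le_trans _ _ (n%:R * (L * D))).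
  apply: le_trans (enorm_sum _ _ _) _.
  apply: le_trans (sum_const_le xpredT _); last by rewrite mulr_ge0 // ltW.
  apply: ler_sum => j _; apply: le_trans (f_lip _ _ _) _.
  by rewrite ler_wpM2l ?(ltW L_gt0) // inner_iterate_dist.
rewrite mulrC ler_pM2r // /D.
set G := enorm _.
have : 4 * (alpha * n%:R * L) * G <= 1 * G by rewrite ler_wpM2r ?enorm_ge0.
rewrite -/(mean_gradient x) -/G; lra.
Qed.

(** Write [c = alpha n]. Polarising [<m, g>] in the descent inequality and using
    [|g - m|^2 <= |m|^2 + r^2 / 4] cancels [|m|^2] and leaves a change of at most
    [- 3 c / 8 |g|^2 + c r^2 / 8]; then [|g| > r]. *)
Lemma epoch_descent (r : R) : 8 * (alpha * L * M) ^+ 2 <= r ^+ 2 -> 0 <= r ->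
  r < enorm (epoch_gradient f alpha s x) ->
  average f (y n) - average f x < - (alpha * n%:R / 4 * r ^+ 2).
Proof.
move=> Mr r0; set g := epoch_gradient f alpha s x => rg.
have gr : r ^+ 2 < dot g g by rewrite -sqr_enorm ltr_pXn2r ?nnegrE ?enorm_ge0.
rewrite inner_iterate_last -/g.
have := average_descent x (- ((alpha * n%:R) *: g)).
rewrite !dotNr dotNl !(dotZr (alpha * n%:R)) (dotZl (alpha * n%:R)) opprK.
set m := mean_gradient x; set c := alpha * n%:R.
have c0 : 0 < c by rewrite mulr_gt0 ?ltr0n.
have err : dot (g - m) (g - m) <= dot m m + r ^+ 2 / 4.
  rewrite -!sqr_enorm; have := epoch_gradient_error; rewrite -/g -/m.
  set E := enorm (g - m); set G := enorm m; set b := alpha * L * M.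
  move=> EG; have : E ^+ 2 <= (G / 3 + 4 / 3 * b) ^+ 2.
    apply: lerXn2r; rewrite ?nnegrE ?addr_ge0 ?mulr_ge0 ?enorm_ge0 //.
      exact: ltW alpha_gt0.
    exact: ltW L_gt0.
  (* [G^2 + 2 b^2 - (G / 3 + 4 b / 3)^2 = 2 / 9 (2 G - b)^2], and [Mr] says [2 b^2 <= r^2 / 4]. *)
  have := sqr_ge0 (2 * G - b); move: Mr; rewrite -/b; lra.
have smooth : c * (4 * (c * L)) * dot g g <= c * 1 * dot g g.
  by rewrite ler_wpM2r ?dot_ge0 // ler_wpM2l // ltW.
have mg : dot m g = (dot m m + dot g g - dot (g - m) (g - m)) / 2.
  by rewrite !(dotBl, dotBr) (dotC g m); field.
have : c * (dot (g - m) (g - m)) <= c * (dot m m + r ^+ 2 / 4).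
  by rewrite ler_wpM2l // ltW.
have : c * r ^+ 2 < c * dot g g by rewrite ltr_pM2l.
rewrite mg; lra.
Qed.

End InnerLoop.
End Epoch.

(** * Total probability over the values of a finite-valued variable *)

Section FiniteValued.
Variables (R : realType) (disp : measure_display) (Omega : measurableType disp).
Variables (P : probability Omega R) (I : finType) (X : Omega -> I).
Hypothesis X_meas : forall i, measurable (X @^-1` [set i]).

Let partitionE (A : I -> set Omega) :
  [set w | A (X w) w] = \bigcup_(i in [set: I]) (X @^-1` [set i] `&` A i).
Proof.
apply/seteqP; split=> [w Aw|w [i _ [/= <-]] //].
by exists (X w).
Qed.

Lemma measurable_finite_valued (A : I -> set Omega) :
  (forall i, measurable (A i)) -> measurable [set w | A (X w) w].
Proof.
move=> mA; rewrite partitionE; apply: fin_bigcup_measurable => // i _.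
exact: measurableI.
Qed.

Lemma probability_finite_valued (A : I -> set Omega) :
  (forall i, measurable (A i)) ->
  P [set w | A (X w) w] = (\sum_i P (X @^-1` [set i] `&` A i))%E.
Proof.
move=> mA; rewrite partitionE measure_fin_bigcup //=.
- have -> : [set: I] = [set` index_enum I].
    by apply/seteqP; split=> // i _ /=; rewrite mem_index_enum.
  by rewrite -fsbig_seq ?index_enum_uniq.
- by move=> i j _ _ [w [[/= <- _] [/= <- _]]].
- by move=> i _; exact: measurableI.
Qed.

End FiniteValued.

(** * Events determined by the past and the current permutation *)

Section AdaptedPermutations.
Variables (R : realType) (disp : measure_display) (Omega : measurableType disp).
Variables (P : probability Omega R) (n : nat) (p : nat -> Omega -> {perm 'I_n}).
Hypothesis p_meas : forall t, random_permutation (p t).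
Hypothesis p_unif : forall t, uniform_permutation P (p t).
Hypothesis p_indep : independent_of_past P p.

Lemma probability_perm_pred t (B : pred {perm 'I_n}) :
  P (p t @^-1` [set` B]) = (#|B|%:R / #|{perm 'I_n}|%:R)%:E.
Proof.
have h (s : {perm 'I_n}) : measurable (if B s then [set: Omega] else set0).
  by case: ifP.
have -> : p t @^-1` [set` B]
    = [set w | (if B (p t w) then [set: Omega] else set0) w].
  by apply/seteqP; split=> w /=; rewrite /in_mem /=; case: (B (p t w)).
rewrite (@probability_finite_valued _ _ _ P _ (p t) (fun s => p_meas _ _) _ h).
rewrite (bigID B) /= [X in (_ + X)%E]big1 ?adde0; last first.
  by move=> s /negbTE ->; rewrite setI0 measure0.
under eq_bigr => s Bs do rewrite Bs setIT p_unif.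
by rewrite sumEFin (sumr_const B) mulr_natl.
Qed.

Variables (t : nat) (bad : (nat -> {perm 'I_n}) -> pred {perm 'I_n}) (b : R).
Hypothesis bad_past :
  forall s s', (forall u, (u < t)%N -> s u = s' u) -> bad s =1 bad s'.

Let past w : {ffun 'I_t -> {perm 'I_n}} := [ffun u : 'I_t => p u w].
(** Completes a finite history to an infinite sequence; the identity at times from [t] on is an
    arbitrary default, harmless by [bad_past]. *)
Let extend (c : {ffun 'I_t -> {perm 'I_n}}) (u : nat) : {perm 'I_n} :=
  if insub u is Some i then c i else 1%g.

(** Puts the conditioning event in the product form in which [independent_of_past] is stated. *)
Let pastE c : past @^-1` [set c]
  = [set w | forall u, (u < t)%N -> [set extend c u] (p u w)].
Proof.
apply/seteqP; split=> w /=.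
  by move=> <- u ut; rewrite /= /extend insubT ffunE.
move=> h; apply/ffunP => u; rewrite ffunE h //.
by rewrite /extend valK.
Qed.

Let past_meas c : measurable (past @^-1` [set c]).
Proof.
rewrite pastE.
have -> : [set w | forall u, (u < t)%N -> [set extend c u] (p u w)]
    = \bigcap_(u in [set u | (u < t)%N]) (p u @^-1` [set extend c u]).
  by [].
by apply: bigcap_measurableType => u _; exact: p_meas.
Qed.

Let badE : [set w | bad (fun u => p u w) (p t w)]
  = [set w | (p t @^-1` [set` bad (extend (past w))]) w].
Proof.
have h w : bad (fun u => p u w) =1 bad (extend (past w)).
  by apply: bad_past => u ut; rewrite /extend insubT ffunE.
by apply/seteqP; split=> w /=; rewrite /in_mem /= h.
Qed.

Lemma measurable_adapted : measurable [set w | bad (fun u => p u w) (p t w)].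
Proof.
rewrite badE; apply: (measurable_finite_valued past_meas
  (A := fun c => p t @^-1` [set` bad (extend c)])) => c.
exact: p_meas.
Qed.

(** There are finitely many histories. Given one of them the bad set is fixed and [p t] is still
    uniform, so its conditional probability is at most [b]; the histories have total probability
    1. *)
Lemma probability_adapted_le :
  (forall s, #|bad s|%:R <= #|{perm 'I_n}|%:R * b) ->
  (P [set w | bad (fun u => p u w) (p t w)] <= b%:E)%E.
Proof.
move=> card_bad; have N0 : 0 < #|{perm 'I_n}|%:R :> R.
  by rewrite ltr0n; apply/card_gt0P; exists 1%g.
rewrite badE (probability_finite_valued P past_meas
  (A := fun c => p t @^-1` [set` bad (extend c)])); last by move=> c; exact: p_meas.
have total : (\sum_c P (past @^-1` [set c]) = 1)%E.
  rewrite -(@probability_setT _ _ _ P).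
  have -> : [set: Omega] = [set w | (fun=> [set: Omega]) (past w) w] by [].
  rewrite (probability_finite_valued P past_meas (A := fun=> setT)) //.
  by apply: eq_bigr => c _; rewrite setIT.
apply: (@le_trans _ _ (\sum_c b%:E * P (past @^-1` [set c]))%E); last first.
  by rewrite -ge0_sume_distrr // total mule1.
apply: lee_sum => c _; rewrite setIC pastE.
rewrite (p_indep t _ (fun u => [set extend c u])).
apply: lee_wpmul2r => //.
by rewrite probability_perm_pred lee_fin ler_pdivrMr // mulrC.
Qed.

End AdaptedPermutations.

(** * Dyadic blocks of epochs *)

Section Blocks.

Lemma block_startS k : block_start k.+1 = (block_start k + block_size k)%N.
Proof. exact: big_ord_recr. Qed.

Lemma block_startE k : (block_start k).+1 = (2 ^ k)%N.
Proof.
elim: k => [|k IH]; first by rewrite /block_start big_ord0.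
by rewrite block_startS -addSn IH /block_size addnn expnS mul2n.
Qed.

(** Block [k] consists of the [t] with [2^k <= t + 1 < 2^(k+1)]. *)
Definition block_of (t : nat) : nat := trunc_log 2 t.+1.

Lemma block_ofP t (k := block_of t) :
  (block_start k <= t < block_start k + block_size k)%N.
Proof.
rewrite -block_startS -ltnS block_startE -[in X in _ && X]ltnS block_startE.
exact: trunc_log_bounds.
Qed.

Lemma block_of_eq k t :
  (block_start k <= t < block_start k + block_size k)%N -> block_of t = k.
Proof.
rewrite -block_startS -ltnS block_startE -[in X in _ && X]ltnS block_startE.
exact: trunc_log_eq.
Qed.

Lemma sum_blocks (R : realType) (h g : nat -> R) K :
  (forall k t, (block_start k <= t < block_start k + block_size k)%N ->
    h t = g k) ->
  \sum_(0 <= t < block_start K) h t = \sum_(k < K) (block_size k)%:R * g k.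
Proof.
move=> hg; elim: K => [|K IH]; first by rewrite /block_start !big_ord0 big_geq.
rewrite big_ord_recr /= -IH block_startS.
rewrite (big_cat_nat (leq0n _) (leq_addr _ _)) /=; congr (_ + _).
rewrite (eq_big_nat _ _ (fun t tb => hg K t tb)).
by rewrite sumr_const_nat addKn mulr_natl.
Qed.

End Blocks.

(** * Failure probabilities and step sizes of the blocks *)

Section StepSizes.
Variables (R : realType) (n : nat) (L eta eps delta : R).
Hypotheses (n_gt0 : (0 < n)%N) (L_gt0 : 0 < L) (delta01 : 0 < delta < 1).

Let delta_gt0 : 0 < delta. Proof. by case/andP: delta01. Qed.

Let n_ge1 : 1 <= n%:R :> R. Proof. by rewrite ler1n. Qed.

Let size_ge1 k : 1 <= (block_size k)%:R :> R.
Proof. by rewrite ler1n expn_gt0. Qed.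

Let sqr_pi_ge4 : 4 <= pi ^+ 2 :> R.
Proof. have := @pi_ge2 R; nra. Qed.

Let block_delta_gt0 k : 0 < block_delta delta k.
Proof.
by rewrite /block_delta divr_gt0 ?mulr_gt0 ?exprn_gt0 ?pi_gt0 ?ltr0n.
Qed.

Let block_delta_le k : block_delta delta k <= 3 / 2 * delta * (k.+1%:R ^+ 2)^-1.
Proof.
have k0 : 0 < k.+1%:R ^+ 2 :> R by rewrite exprn_gt0 ?ltr0n.
rewrite /block_delta invfM mulrA ler_pM2r ?invr_gt0 //.
rewrite ler_pdivrMr ?exprn_gt0 ?pi_gt0 //.
have := sqr_pi_ge4; have := delta_gt0; nra.
Qed.

Lemma expR_block_log k :
  expR (- block_log n delta k)
    = block_delta delta k / (8 * n%:R * (block_size k)%:R).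
Proof.
have n0 : 0 < n%:R :> R by rewrite ltr0n.
have s0 : 0 < (block_size k)%:R :> R by have := size_ge1 k; lra.
have q0 : 0 < 8 * n%:R * (block_size k)%:R / block_delta delta k.
  by apply: divr_gt0 => //; rewrite !mulr_gt0.
by rewrite expRN lnK // [LHS]invf_div.
Qed.

(** This makes the tail bound applicable: [exp (4 / 3) <= (3 / 2)^4 <= 16 / 3 <= 8 n S_k / delta_k],
    the last step because [delta_k <= 3 / 2]. *)
Lemma block_log_ge k : 4 / 3 <= block_log n delta k.
Proof.
rewrite -ler_expR -[block_log n delta k]opprK [in leRHS]expRN expR_block_log invf_div.
have n0 : 0 < n%:R :> R by rewrite ltr0n.
have d32 : block_delta delta k <= 3 / 2.
  apply: le_trans (block_delta_le k) _.
  have : (k.+1%:R ^+ 2)^-1 <= 1 :> R.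
    by rewrite invf_le1 ?exprn_gt0 ?ltr0n // exprn_ege1 // ler1n.
  have : 0 <= (k.+1%:R ^+ 2)^-1 :> R by rewrite invr_ge0 exprn_ge0.
  move: (_^-1) => r r0 r1; case/andP: delta01 => d0 d1; nra.
apply: (@le_trans _ _ (16 / 3)); last first.
  rewrite ler_pdivlMr //; have := size_ge1 k; have := n_ge1.
  have := block_delta_gt0 k; nra.
have -> : 4 / 3 = 4%:R * 3^-1 :> R by [].
(* Inverse of [exp (- 1 / 3) >= 2 / 3]. *)
have e3 : expR (3^-1) <= 3 / 2 :> R.
  have := expR_ge1Dx (- 3^-1 : R); have := expRxMexpNx_1 (3^-1 : R).
  have := expR_gt0 (3^-1 : R); nra.
rewrite expRM_natl; apply: (@le_trans _ _ ((3 / 2) ^+ 4)); last by lra.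
by apply: lerXn2r; rewrite ?nnegrE ?expR_ge0.
Qed.

Let sum_inv_sqr_le K : \sum_(k < K) (k.+1%:R ^+ 2)^-1 <= 2 :> R.
Proof.
have telescope_le m : \sum_(k < m.+1) (k.+1%:R ^+ 2)^-1 <= 2 - m.+1%:R^-1 :> R.
  elim: m => [|m IH]; first by rewrite big_ord1 expr1n invr1; lra.
  rewrite big_ord_recr /=; apply: le_trans (lerD IH (lexx _)) _.
  have a0 : 0 < m.+1%:R :> R by rewrite ltr0n.
  rewrite -[m.+2%:R]natr1; set a := m.+1%:R : R; rewrite -subr_ge0.
  have -> : 2 - (a + 1)^-1 - (2 - a^-1 + ((a + 1) ^+ 2)^-1)
      = (a * (a + 1) ^+ 2)^-1.
    by field; rewrite !gt_eqF // addr_gt0.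
  by rewrite invr_ge0 mulr_ge0 ?exprn_ge0 ?addr_ge0 // ltW.
case: K => [|m]; first by rewrite big_ord0.
apply: le_trans (telescope_le m) _.
by rewrite gerBl invr_ge0.
Qed.

(** This is [n exp (- ell_k)] for the block [k] of [t]: the union bound over the [n] partial sums of
    one epoch. *)
Definition epoch_delta (t : nat) : R :=
  block_delta delta (block_of t) / (8 * (block_size (block_of t))%:R).

Lemma epoch_delta_ge0 t : 0 <= epoch_delta t.
Proof. by rewrite divr_ge0 // ltW. Qed.

Lemma sum_epoch_delta_le N : \sum_(0 <= t < N) epoch_delta t <= delta.
Proof.
(* Enlarging the range to [N] whole blocks, block [k] contributes
   [delta_k / 8 <= 3 / 16 * delta / (k+1)^2], in total at most [3 / 8 * delta]. *)
have leN : (N <= block_start N)%N by rewrite -ltnS block_startE ltn_expl.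
apply: (@le_trans _ _ (\sum_(0 <= t < block_start N) epoch_delta t)).
  rewrite (big_cat_nat (leq0n _) leN) /= lerDl sumr_ge0 // => t _.
  exact: epoch_delta_ge0.
rewrite (sum_blocks (g := fun k => block_delta delta k / (8 * (block_size k)%:R))).
  apply: (@le_trans _ _ (\sum_(k < N) 3 / 16 * delta * (k.+1%:R ^+ 2)^-1)).
    apply: ler_sum => k _; have s0 : 0 < (block_size k)%:R :> R.
      by have := size_ge1 k; lra.
    have -> : (block_size k)%:R * (block_delta delta k / (8 * (block_size k)%:R))
        = block_delta delta k / 8 :> R.
      by field; rewrite gt_eqF.
    by have := block_delta_le k; move: (k.+1%:R ^+ 2)^-1 => r; lra.
  rewrite -mulr_sumr; have := sum_inv_sqr_le N; have := delta_gt0; nra.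
by move=> k t /block_of_eq <-.
Qed.

Section Bounds.
Variable F : R.
Hypotheses (F_ge0 : 0 <= F) (eta_gt0 : 0 < eta) (eps_gt0 : 0 < eps).
Let step k := block_stepsize n L F eta eps delta k.
Let ell k := block_log n delta k.

Let n_gt0' : 0 < n%:R :> R. Proof. by rewrite ltr0n. Qed.

Let ell_gt0 k : 0 < ell k.
Proof. by have := block_log_ge k; rewrite /ell; lra. Qed.

Let denom_gt0 k : F != 0 -> 0 < 8 * Num.sqrt (n%:R * constA L * F) * L * ell k.
Proof.
move=> Fn0; rewrite !mulr_gt0 // sqrtr_gt0 !mulr_gt0 //.
by rewrite lt_def Fn0.
Qed.

Lemma block_stepsize_gt0 k : 0 < step k.
Proof.
have a0 : 0 < 1 / (4 * n%:R * L) by rewrite divr_gt0 // !mulr_gt0.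
rewrite /step /block_stepsize; case: ifPn => // Fn0.
by rewrite lt_min a0 divr_gt0 ?denom_gt0 ?mulr_gt0.
Qed.

Lemma block_stepsize_le k : 4 * (step k * n%:R * L) <= 1.
Proof.
have : step k <= 1 / (4 * n%:R * L).
  by rewrite /step /block_stepsize; case: ifP => // _; rewrite ge_min lexx.
by rewrite ler_pdivlMr ?mulr_gt0 //; lra.
Qed.

(** The second term of the minimum, squared and cleared of denominators, so that the case [F = 0] is
    covered too. *)
Lemma block_stepsize_sqr_le k :
  64 * (n%:R * constA L * F) * (step k * L * ell k) ^+ 2 <= (eta * eps) ^+ 2.
Proof.
have [->|Fn0] := eqVneq F 0; first by rewrite !mulr0 mul0r sqr_ge0.
have : step k <= eta * eps / (8 * Num.sqrt (n%:R * constA L * F) * L * ell k).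
  by rewrite /step /block_stepsize (negbTE Fn0) ge_min lexx orbT.
rewrite ler_pdivlMr ?denom_gt0 // => h.
have nAF0 : 0 <= n%:R * constA L * F by rewrite !mulr_ge0 // ltW.
rewrite -[X in 64 * X](sqr_sqrtr nAF0).
set q := Num.sqrt _ in h *.
have -> : 64 * q ^+ 2 * (step k * L * ell k) ^+ 2
    = (step k * (8 * q * L * ell k)) ^+ 2 by ring.
apply: lerXn2r => //; rewrite nnegrE mulr_ge0 ?(ltW eta_gt0) ?(ltW eps_gt0) //.
  exact/ltW/block_stepsize_gt0.
by rewrite ltW // denom_gt0.
Qed.

End Bounds.
End StepSizes.

(** * Stopping time and dependence of the iterates on the past *)

Section StoppingTime.

Lemma lt_first_time (R : realType) (stop : nat -> bool) t :
  (t%:R%:E < first_time R stop)%E -> forall u, (u <= t)%N -> ~~ stop u.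
Proof.
rewrite /first_time; case: pselect => [ex_stop|no_stop _ u _]; last first.
  by apply/negP => stop_u; apply: no_stop; exists u.
rewrite lte_fin ltr_nat; case: ex_minnP => m _ min_m tm u ut.
by apply/negP => /min_m; rewrite leqNgt (leq_ltn_trans ut tm).
Qed.

Lemma eq_rrsc_iterate (R : realType) (d n : nat) (f : 'I_n -> 'rV[R]_d -> R)
    alpha x0 s s' t : (forall u, (u < t)%N -> s u = s' u) ->
  rrsc_iterate f alpha x0 s t = rrsc_iterate f alpha x0 s' t.
Proof.
elim: t => //= t IH ss'; rewrite IH ?ss' // => u ut.
by rewrite ss' // ltnW.
Qed.

End StoppingTime.

(** * Good event, decrease along the run and bound on the stopping time *)

Lemma card_exists_le (I T : finType) (Q : I -> pred T) :
  (#|[pred x | [exists i, Q i x]]| <= \sum_i #|Q i|)%N.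
Proof.
under [leqRHS]eq_bigr => i _ do rewrite -sum1_card.
rewrite (exchange_big_dep xpredT) //= -sum1_card big_mkcond /=.
apply: leq_sum => x _; case: ifP => // /existsP[i Qix].
by rewrite (bigD1 i).
Qed.

Theorem proposition4p2 (R : realType) (d n : nat) (hn : (0 < n)%N)
  (f : 'I_n -> 'rV[R]_d -> R)
  (hC1 : forall i, continuously_differentiable (f i))
  (fibar : 'I_n -> R) (hfibar : forall i x, fibar i <= f i x)
  (L : R) (hL : 0 < L) (hLip : forall i, gradient_lipschitz L (f i))
  (fbar : R) (hfbar : forall x, fbar <= average f x)
  (hB : 0 <= constB L fbar fibar)
  (x0 : 'rV[R]_d)
  (eta eps : R) (heta : 0 < eta) (heps : 0 < eps)
  (delta : R) (hdelta : 0 < delta < 1)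
  (alpha : nat -> R)
  (halpha : forall k t : nat,
     (block_start k <= t < block_start k + block_size k)%N ->
     alpha t = block_stepsize n L (constF f L fbar fibar x0) eta eps delta k)
  (disp : measure_display) (Omega : measurableType disp)
  (P : probability Omega R)
  (p : nat -> Omega -> {perm 'I_n})
  (hp_meas : forall t, random_permutation (p t))
  (hp_unif : forall t, uniform_permutation P (p t))
  (hp_indep : independent_of_past P p) :
  let x w t := rrsc_iterate f alpha x0 (fun u => p u w) t in
  let tau w := rrsc_stopping_time f eta eps alpha x0 (fun u => p u w) in
  exists E : set Omega,
    [/\ measurable E,
        ((1 - delta)%:E <= P E)%E,
        forall w t, E w -> (t%:R%:E < tau w)%E ->
          average f (x w t.+1) - average f (x w t)
            < - (alpha t * n%:R / 4 * eta ^+ 2 * eps ^+ 2)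
      & forall K : nat,
          average f x0 - fbar
            <= \sum_(k < K.+1)
                 n%:R * (block_size k)%:R
                 * block_stepsize n L (constF f L fbar fibar x0)
                     eta eps delta k
                 / 4 * eta ^+ 2 * eps ^+ 2 ->
          forall w, E w -> (tau w <= ((block_start K.+1)%:R - 1)%:E)%E].
Proof.
move=> x tau.
set F := constF f L fbar fibar x0 in halpha *.
have n0 : 0 < n%:R :> R by rewrite ltr0n.
have f_diff i y : differentiable (f i) y by have [] := hC1 i.
have A0 : 0 < constA L by rewrite mulr_gt0.
have F0 : 0 <= F.
  have := hfbar x0; have : 0 <= 3 * constB L fbar fibar / constA L.
    by apply: divr_ge0 (ltW A0); apply: mulr_ge0.
  by rewrite /F /constF; lra.
(* [fbar] cancels between the two terms of [F], which makes [n A F] three times the dispersion bound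
   at [x0]. *)
have nAFE : n%:R * constA L * F
    = 6 * L * (n%:R * average f x0 - \sum_(i < n) fibar i).
  rewrite /F /constF /constB /constA sumrB sumr_const card_ord -[fbar *+ n]mulr_natl.
  by field; rewrite !gt_eqF.
pose ell t := block_log n delta (block_of t).
have alphaE t : alpha t = block_stepsize n L F eta eps delta (block_of t).
  exact/halpha/block_ofP.
have alpha_gt0 t : 0 < alpha t by rewrite alphaE block_stepsize_gt0.
have ell_ge t : 4 / 3 <= ell t by apply: block_log_ge.
pose psum y (r : {perm 'I_n}) (i : nat) :=
  \sum_(j < n | (j < i)%N) gradient_dev f y (r j).
(* The past [s] fixes the iterate [y], so that the tail bound can be applied by counting the current
   permutations [r] alone. *)
pose bad t s (r : {perm 'I_n}) :=
  let y := rrsc_iterate f alpha x0 s t in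
  [exists i : 'I_n, 24 * gradient_dispersion f y * ell t ^+ 2
    < dot (psum y r i) (psum y r i)].
pose badE t := [set w | bad t (fun u => p u w) (p t w)].
have bad_past t s s' : (forall u, (u < t)%N -> s u = s' u) ->
    bad t s =1 bad t s'.
  by move=> ss' r; rewrite /bad (eq_rrsc_iterate _ _ _ ss').
have card_bad t s :
    #|bad t s|%:R <= #|{perm 'I_n}|%:R * epoch_delta delta t.
  apply: (@le_trans _ _ (\sum_(i < n) #|{perm 'I_n}|%:R * expR (- ell t))).
    apply: (@le_trans _ _ (\sum_(i < n) #|[pred r | 24 *
        gradient_dispersion f (rrsc_iterate f alpha x0 s t) * ell t ^+ 2
        < dot (psum (rrsc_iterate f alpha x0 s t) r i)
              (psum (rrsc_iterate f alpha x0 s t) r i)]|%:R)).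
      by rewrite -natr_sum ler_nat; exact: card_exists_le.
    apply: ler_sum => i _; apply: tail_partial_sum => //.
    exact: sum_gradient_dev.
  rewrite sumr_const card_ord -mulrnAr ler_wpM2l // expR_block_log //.
  rewrite -mulr_natl /epoch_delta; set D := block_delta _ _.
  have s0 : 0 < (block_size (block_of t))%:R :> R by rewrite ltr0n expn_gt0.
  by rewrite le_eqVlt; apply/orP; left; apply/eqP; field; rewrite !gt_eqF.
have badE_meas t : measurable (badE t).
  exact: (measurable_adapted hp_meas (bad_past t)).
have badE_le t : (P (badE t) <= (epoch_delta delta t)%:E)%E.
  exact: (probability_adapted_le hp_meas hp_unif hp_indep (bad_past t)).
have U_meas : measurable (\bigcup_t badE t).
  exact: bigcup_measurable.
have U_le : (P (\bigcup_t badE t) <= delta%:E)%E.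
  apply: le_trans (generalized_Boole_inequality P badE_meas U_meas) _.
  apply: lime_le; first exact: is_cvg_nneseries.
  near=> N; apply: (@le_trans _ _ (\sum_(0 <= t < N) (epoch_delta delta t)%:E)%E).
    by apply: lee_sum => t _; exact: badE_le.
  by rewrite sumEFin lee_fin sum_epoch_delta_le.
have descent w t : (~` \bigcup_t badE t) w ->
    average f (x w t) <= average f x0 ->
    ~~ rrsc_stop f eta eps alpha x0 (fun u => p u w) t ->
    average f (x w t.+1) - average f (x w t)
      < - (alpha t * n%:R / 4 * eta ^+ 2 * eps ^+ 2).
  move=> Ew x_le; rewrite /rrsc_stop -ltNge -/(x w t) => not_stop.
  set V := gradient_dispersion f (x w t).
  have V0 : 0 <= V by apply: sumr_ge0 => i _; exact: dot_ge0.
  have ell0 : 0 <= ell t by have := ell_ge t; lra.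
  have -> : alpha t * n%:R / 4 * eta ^+ 2 * eps ^+ 2
      = alpha t * n%:R / 4 * (eta * eps) ^+ 2 by ring.
  (* [M] is the square root of the tail threshold [24 V l^2]. *)
  apply: (epoch_descent hn f_diff hL hLip (M := Num.sqrt (24 * V) * ell t)
    (alpha_gt0 t) _ _ _ _ not_stop).
  - by rewrite alphaE block_stepsize_le.
  - move=> i i_lt; rewrite leNgt; apply/negP => lt_i; apply: Ew.
    exists t => //; apply/existsP; exists (Ordinal i_lt) => /=.
    rewrite -/V -sqr_enorm -[24 * V]sqr_sqrtr ?mulr_ge0 // -exprMn.
    by rewrite ltr_pXn2r // nnegrE ?enorm_ge0 // mulr_ge0 ?sqrtr_ge0.
  - have := @block_stepsize_sqr_le _ n L eta eps delta hn hL hdelta F F0 heta heps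
      (block_of t).
    rewrite nAFE -alphaE -/(ell t).
    have := gradient_dispersion_le hn f_diff hL hLip (x w t) hfibar.
    rewrite -/V => V_le.
    (* The only place where [f (x_t) <= f x0] enters: it gives [3 V <= n A F]. *)
    have : 3 * V <= 6 * L * (n%:R * average f x0 - \sum_(i < n) fibar i).
      have : L * (n%:R * average f (x w t)) <= L * (n%:R * average f x0).
        by rewrite (ler_pM2l hL) (ler_pM2l n0).
      lra.
    set a := alpha t * L * ell t => V3.
    have -> : 8 * (alpha t * L * (Num.sqrt (24 * V) * ell t)) ^+ 2
        = 64 * (3 * V) * a ^+ 2.
      have -> : alpha t * L * (Num.sqrt (24 * V) * ell t)
          = a * Num.sqrt (24 * V) by rewrite /a; ring.
      by rewrite exprMn sqr_sqrtr ?mulr_ge0 //; ring.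
    apply: le_trans.
    by rewrite ler_wpM2r ?sqr_ge0 // ler_wpM2l.
  - by rewrite mulr_ge0 // ltW.
(* The induction also maintains the premise of [descent]: the accumulated decrease is nonnegative,
   so the values stay below [f x0]. *)
have sum_descent w m : (~` \bigcup_t badE t) w ->
    (forall u, (u < m)%N ->
      ~~ rrsc_stop f eta eps alpha x0 (fun u => p u w) u) ->
    average f (x w m) <= average f x0
      - \sum_(0 <= u < m) alpha u * n%:R / 4 * eta ^+ 2 * eps ^+ 2.
  move=> Ew; elim: m => [|m IH] not_stop; first by rewrite big_geq // subr0.
  have := IH (fun u um => not_stop u (ltnW um)).
  rewrite big_nat_recr //=; set S := \sum_(0 <= _ < m) _ => le_m.
  have S0 : 0 <= S.
    by apply: sumr_ge0 => u _; rewrite !mulr_ge0 ?exprn_ge0 // ltW.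
  have := descent w m Ew _ (not_stop m (ltnSn m)).
  have {}le_x0 : average f (x w m) <= average f x0 by lra.
  by move=> /(_ le_x0); lra.
have descent_tau w t : (~` \bigcup_t badE t) w -> (t%:R%:E < tau w)%E ->
    average f (x w t) <= average f x0
      - \sum_(0 <= u < t) alpha u * n%:R / 4 * eta ^+ 2 * eps ^+ 2 /\
    average f (x w t.+1) - average f (x w t)
      < - (alpha t * n%:R / 4 * eta ^+ 2 * eps ^+ 2).
  move=> Ew /lt_first_time not_stop.
  have le_t := sum_descent w t Ew (fun u ut => not_stop u (ltnW ut)).
  split=> //; apply: descent (not_stop t (leqnn t)) => //.
  apply: le_trans le_t _; rewrite gerBl; apply: sumr_ge0 => u _.
  by rewrite !mulr_ge0 ?exprn_ge0 // ltW.
(* The exceptional sets of all epochs of the continued recursion are removed, so the event is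
   defined without reference to [tau]. *)
exists (~` \bigcup_t badE t); split.
- exact: measurableC.
- rewrite probability_setC //.
  rewrite EFinB; apply: leeB => //.
- by move=> w t Ew /(descent_tau _ _ Ew)[].
move=> K K_le w Ew; rewrite leNgt; apply/negP.
have -> : (block_start K.+1)%:R - 1 = (block_start K.+1).-1%:R :> R.
  by rewrite -[in LHS](prednK (n := block_start K.+1)) -?natr1 ?addrK // -ltnS
    block_startE (@leq_exp2l 2 1).
have T0 : (0 < block_start K.+1)%N.
  by rewrite -ltnS block_startE (@leq_exp2l 2 1).
(* With [T] the start of block [K + 1], [T - 1 < tau] would mean no stop up to epoch [T - 1], whence
   [f (x_T)] is below [f x0] minus the full sum, so below [fbar]. The last decrease being strict,
   equality in the assumption on [K] is allowed. *)
move=> /(descent_tau _ _ Ew)[].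
have := hfbar (x w (block_start K.+1).-1.+1).
have : \sum_(0 <= u < (block_start K.+1).-1.+1)
    alpha u * n%:R / 4 * eta ^+ 2 * eps ^+ 2
  = \sum_(k < K.+1) n%:R * (block_size k)%:R * block_stepsize n L F eta eps delta k
      / 4 * eta ^+ 2 * eps ^+ 2.
  rewrite prednK // (sum_blocks (g := fun k =>
    block_stepsize n L F eta eps delta k * n%:R / 4 * eta ^+ 2 * eps ^+ 2)).
    by apply: eq_bigr => k _; ring.
  by move=> k t /halpha ->.
rewrite big_nat_recr //=; move: K_le; rewrite -/F; lra.
Unshelve. all: by end_near.
Qed.
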